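(* Let $T>0$, $x_0,x_f\in\mathbb{R}^n$, $\lambda\in\mathbb{R}^p$, and let $f^0,f_1,F_2,g_1,G_2,R$ be as in the context. Let $\tilde x,\tilde p_x:[0,T]\to\mathbb{R}^n$ be absolutely continuous and put $$u^\star(t)=-R^{-1}\big(F_2(\tilde x(t))^\top\tilde p_x(t)+G_2(\tilde x(t))^\top\lambda\big).$$ Then $(\tilde x(\cdot),\tilde p_x(\cdot))$ satisfies the reduced boundary value problem RBVP($\lambda$) $$\begin{aligned}\dot x&=f_1(x)-F_2(x)R^{-1}\big(F_2(x)^\top p_x+G_2(x)^\top\lambda\big),\\ \dot p_x&=-\nabla f^0(x)-\Big(Df_1(x)^\top+\big(DF_2(x)[\,\cdot\,]u^\star\big)^\top\Big)p_x-\Big(Dg_1(x)^\top+\big(DG_2(x)[\,\cdot\,]u^\star\big)^\top\Big)\lambda,\\ x(0)&=x_0,\qquad x(T)=x_f,\end{aligned}$$ if and only if $(\tilde x(\cdot),\tilde p_x(\cdot),u^\star(\cdot))$ is an extremal of the reduced optimal control problem $\mathrm{ROCP}(\lambda)$: $$\min_{u(\cdot)\in L^\infty([0,T];\mathbb{R}^m)}\int_0^T\Big(f^0(x)+\tfrac12u^\top Ru+\lambda^\top\big(g_1(x)+G_2(x)u\big)\Big)dt$$ subject to $\dot x=f_1(x)+F_2(x)u$, $x(0)=x_0$, $x(T)=x_f$.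
   Context: Data: $f^0:\mathbb{R}^n\to\mathbb{R}$, $f_1:\mathbb{R}^n\to\mathbb{R}^n$, $g_1:\mathbb{R}^n\to\mathbb{R}^p$, $F_2:\mathbb{R}^n\to\mathbb{R}^{n\times m}$, $G_2:\mathbb{R}^n\to\mathbb{R}^{p\times m}$ are of class $C^2$, and $R\in\mathbb{R}^{m\times m}$ is constant, symmetric and positive definite. Notation: $Df_1,Dg_1$ are Jacobian matrices. $DF_2(x)[\,\cdot\,]u$ is the linear map $h\mapsto (DF_2(x)[h])u$ from $\mathbb{R}^n$ to $\mathbb{R}^n$, so that $(DF_2(x)[\,\cdot\,]u)^\top p_x=\nabla_x\big(p_x^\top F_2(x)u\big)$ with $u,p_x$ held fixed; similarly $(DG_2(x)[\,\cdot\,]u)^\top\lambda=\nabla_x\big(\lambda^\top G_2(x)u\big)$ with $u,\lambda$ held fixed. Extremals: the Hamiltonian of $\mathrm{ROCP}(\lambda)$ (normal case, cost multiplier equal to $1$) is $$H^\lambda(x,p_x,u)=f^0(x)+\tfrac12u^\top Ru+\lambda^\top(g_1(x)+G_2(x)u)+p_x^\top(f_1(x)+F_2(x)u).$$ A triple $(x(\cdot),p_x(\cdot),u(\cdot))$ is an extremal of $\mathrm{ROCP}(\lambda)$ if $\dot x=\nabla_{p_x}H^\lambda(x,p_x,u)$, $\dot p_x=-\nabla_xH^\lambda(x,p_x,u)$, $\nabla_uH^\lambda(x,p_x,u)=0$ for almost every $t\in[0,T]$, and $x(0)=x_0$, $x(T)=x_f$. *)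

(* Defs.v *)
From HB Require Import structures.
From mathcomp Require Import all_boot all_order all_algebra.
From mathcomp Require Import all_classical all_reals all_analysis.
Import Order.TTheory GRing.Theory Num.Theory.
Import numFieldNormedType.Exports.

Set Implicit Arguments.
Unset Strict Implicit.
Unset Printing Implicit Defensive.

Local Open Scope classical_set_scope.
Local Open Scope ring_scope.

(* Points of R^n are column vectors 'cV[K]_n over a realType K.  A function on
   [0, T] is a total function on K whose values outside [0, T] are never
   constrained: the derivatives below are taken at almost every point of
   [0, T], hence at interior points only. *)

(* Class C^k.  For a finite-dimensional V, continuity of a derivative in
   operator norm is continuity of v-directional derivatives for every v. *)
Fixpoint is_Ck (K : realType) (V W : normedModType K) (k : nat) (f : V -> W)
    : Prop :=
  match k with
  | 0 => continuous f
  | k'.+1 => (forall x, differentiable f x) /\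
             (forall v, is_Ck k' (fun x => 'D_v f x))
  end.

Definition dotc (K : realType) (n : nat) (u v : 'cV[K]_n) : K :=
  (u^T *m v) 0 0.

Definition symmetric_mx (K : realType) (m : nat) (A : 'M[K]_m) : Prop :=
  A^T = A.

Definition posdef_mx (K : realType) (m : nat) (A : 'M[K]_m) : Prop :=
  forall u : 'cV[K]_m, u != 0 -> 0 < dotc u (A *m u).

(* The library's 'J and lin1_mx act on row vectors; this is the matrix A with
   L h = A *m h, for L linear on column vectors. *)
Definition col_lin_mx (K : realType) (n k : nat) (L : 'cV[K]_n -> 'cV[K]_k)
    : 'M[K]_(k, n) :=
  \matrix_(i, j) L (delta_mx j 0) i 0.

Definition jac (K : realType) (n k : nat) (f : 'cV[K]_n -> 'cV[K]_k)
    (x : 'cV[K]_n) : 'M[K]_(k, n) :=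
  col_lin_mx ('d f x).

Definition grad (K : realType) (n : nat) (phi : 'cV[K]_n -> K)
    (x : 'cV[K]_n) : 'cV[K]_n :=
  \col_j 'd phi x (delta_mx j 0).

(* DF(x)[.]u *)
Definition dmat (K : realType) (n k m : nat) (F : 'cV[K]_n -> 'M[K]_(k, m))
    (x : 'cV[K]_n) (u : 'cV[K]_m) : 'M[K]_(k, n) :=
  col_lin_mx (fun h => 'd F x h *m u).

Definition abs_continuous (K : realType) (V : normedModType K) (T : K)
    (f : K -> V) : Prop :=
  forall e : K, 0 < e -> exists2 d : K, 0 < d &
    forall (N : nat) (a b : 'I_N -> K),
      (forall i, 0 <= a i /\ a i <= b i /\ b i <= T) ->
      trivIset [set: 'I_N] (fun i => `]a i, b i[%classic) ->
      \sum_i (b i - a i) < d ->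
      \sum_i `|f (b i) - f (a i)| < e.

Definition ae_on (K : realType) (T : K) (P : K -> Prop) : Prop :=
  {ae (@lebesgue_measure K), forall t, t \in `[0, T] -> P t}.

Definition Linfty (K : realType) (m : nat) (T : K) (u : K -> 'cV[K]_m)
    : Prop :=
  forall i, (fun t : K => u t i 0) \_ `[0, T] \in
    Lfun (@lebesgue_measure K) +oo%E.

(* Minimise \int_0^T cost x u over u in L^infty([0, T]; R^m), subject to
   x' = dyn x u, x 0 = init and x T = final. *)
Record ocp (K : realType) (n m : nat) := Ocp {
  horizon : K;
  cost : 'cV[K]_n -> 'cV[K]_m -> K;
  dyn : 'cV[K]_n -> 'cV[K]_m -> 'cV[K]_n;
  init : 'cV[K]_n;
  final : 'cV[K]_n }.

(* Normal case: the cost multiplier is 1. *)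
Definition hamiltonian (K : realType) (n m : nat) (P : ocp K n m)
    (x px : 'cV[K]_n) (u : 'cV[K]_m) : K :=
  cost P x u + dotc px (dyn P x u).

Record extremal (K : realType) (n m : nat) (P : ocp K n m)
    (x px : K -> 'cV[K]_n) (u : K -> 'cV[K]_m) : Prop := Extremal {
  extremal_ac_state : abs_continuous (horizon P) x;
  extremal_ac_costate : abs_continuous (horizon P) px;
  extremal_control : Linfty (horizon P) u;
  extremal_ae : ae_on (horizon P) (fun t =>
    [/\ is_derive t 1 x (grad (fun q => hamiltonian P (x t) q (u t)) (px t)),
        is_derive t 1 px
          (- grad (fun y => hamiltonian P y (px t) (u t)) (x t)) &
        grad (fun v => hamiltonian P (x t) (px t) v) (u t) = 0]);
  extremal_init : x 0 = init P;
  extremal_final : x (horizon P) = final P }.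

Definition rocp (K : realType) (n m p : nat) (T : K)
    (f0 : 'cV[K]_n -> K) (f1 : 'cV[K]_n -> 'cV[K]_n)
    (F2 : 'cV[K]_n -> 'M[K]_(n, m)) (g1 : 'cV[K]_n -> 'cV[K]_p)
    (G2 : 'cV[K]_n -> 'M[K]_(p, m)) (R : 'M[K]_m) (x0 xf : 'cV[K]_n)
    (lam : 'cV[K]_p) : ocp K n m :=
  {| horizon := T;
     cost := fun x u =>
       f0 x + 2^-1 * dotc u (R *m u) + dotc lam (g1 x + G2 x *m u);
     dyn := fun x u => f1 x + F2 x *m u;
     init := x0;
     final := xf |}.

Definition ustar (K : realType) (n m p : nat)
    (F2 : 'cV[K]_n -> 'M[K]_(n, m)) (G2 : 'cV[K]_n -> 'M[K]_(p, m))
    (R : 'M[K]_m) (lam : 'cV[K]_p) (x px : K -> 'cV[K]_n) (t : K)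
    : 'cV[K]_m :=
  - (invmx R *m ((F2 (x t))^T *m px t + (G2 (x t))^T *m lam)).

Record rbvp (K : realType) (n m p : nat) (T : K)
    (f0 : 'cV[K]_n -> K) (f1 : 'cV[K]_n -> 'cV[K]_n)
    (F2 : 'cV[K]_n -> 'M[K]_(n, m)) (g1 : 'cV[K]_n -> 'cV[K]_p)
    (G2 : 'cV[K]_n -> 'M[K]_(p, m)) (R : 'M[K]_m) (x0 xf : 'cV[K]_n)
    (lam : 'cV[K]_p) (x px : K -> 'cV[K]_n) : Prop := Rbvp {
  rbvp_state : ae_on T (fun t =>
    is_derive t 1 x
      (f1 (x t) -
       F2 (x t) *m invmx R *m ((F2 (x t))^T *m px t + (G2 (x t))^T *m lam)));
  rbvp_costate : ae_on T (fun t =>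
    let u := ustar F2 G2 R lam x px t in
    is_derive t 1 px
      (- grad f0 (x t)
       - ((jac f1 (x t))^T + (dmat F2 (x t) u)^T) *m px t
       - ((jac g1 (x t))^T + (dmat G2 (x t) u)^T) *m lam));
  rbvp_init : x 0 = x0;
  rbvp_final : x T = xf }.

(* Main.v *)
(* For every control u, the Hamiltonian gradients in p and x are exactly the
   right-hand sides of the reduced equations (the latter up to sign) with u in
   place of u*.  Since R is symmetric and invertible, the gradient in u,
   R u + G2(x)^T lambda + F2(x)^T p, vanishes at u = u*, so the equivalence
   holds pointwise in t.  The remaining condition u* in L^infty holds because
   u* is continuous on the compact interval [0, T]. *)
Require Import Defs.
From HB Require Import structures.
From mathcomp Require Import all_boot all_order all_algebra.
From mathcomp Require Import all_classical all_reals all_analysis.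
From mathcomp Require Import measurable_realfun ess_sup_inf.
From mathcomp Require Import lra.
Import Order.TTheory GRing.Theory Num.Theory.
Import numFieldNormedType.Exports.
Local Open Scope classical_set_scope.
Local Open Scope ring_scope.

(** * Limits of matrix-valued maps along a filter *)

Lemma cvg_bigsum {K : realType} {V : normedModType K} {I J : Type}
    {F : set_system I} {FF : Filter F} (r : seq J) (f : J -> I -> V)
    (a : J -> V) :
  (forall j, f j t @[t --> F] --> a j) ->
  \sum_(j <- r) f j t @[t --> F] --> \sum_(j <- r) a j.
Proof.
move=> fa; elim: r => [|j r IH].
  by rewrite big_nil; under eq_fun do rewrite big_nil; exact: cvg_cst.
by rewrite big_cons; under eq_fun do rewrite big_cons; exact: cvgD.
Qed.

Lemma cvg_mxP {K : realType} {m n : nat} {I : Type} {F : set_system I}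
    {FF : Filter F} {f : I -> 'M[K]_(m, n)} {A : 'M[K]_(m, n)} :
  f t @[t --> F] --> A <-> forall i j, f t i j @[t --> F] --> A i j.
Proof.
split=> [fA i j|fA].
  apply: (cvg_comp _ (fun M : 'M[K]_(m, n) => M i j) fA).
  exact: coord_continuous.
(* A neighbourhood of [A] contains all matrices whose entries lie in prescribed neighbourhoods
   [P i j]; there are finitely many entries, so the filter is closed under their intersection. *)
move=> S [P AP PS]; apply: filterS PS _.
apply: filter_forall => i; apply: filter_forall => j.
exact: fA.
Qed.

(** Each entry of the product is a finite sum of products of scalar limits. The filter stays
    arbitrary because it serves both for full neighbourhoods in a matrix space and for
    neighbourhoods relative to $[0,T]$. *)
Lemma cvg_mulmx {K : realType} {m n p : nat} {I : Type} {F : set_system I}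
    {FF : Filter F} {f : I -> 'M[K]_(m, n)} {g : I -> 'M[K]_(n, p)}
    {A : 'M[K]_(m, n)} {B : 'M[K]_(n, p)} :
  f t @[t --> F] --> A -> g t @[t --> F] --> B ->
  f t *m g t @[t --> F] --> A *m B.
Proof.
move=> /cvg_mxP fA /cvg_mxP gB; apply/cvg_mxP => i k; rewrite mxE.
under eq_fun do rewrite mxE.
by apply: cvg_bigsum => j; exact: (cvgM (fA i j) (gB j k)).
Qed.

Lemma cvg_trmx {K : realType} {m n : nat} {I : Type} {F : set_system I}
    {FF : Filter F} {f : I -> 'M[K]_(m, n)} {A : 'M[K]_(m, n)} :
  f t @[t --> F] --> A -> (f t)^T @[t --> F] --> A^T.
Proof.
move=> /cvg_mxP fA; apply/cvg_mxP => i j; rewrite mxE.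
by under eq_fun do rewrite mxE; exact: fA.
Qed.

(** * Differentials of matrix products, transposes and inner products *)

Lemma is_diff_continuous_linear {K : realType} {V W : normedModType K}
    (L : {linear V -> W}) (x : V) : continuous L -> is_diff x L L.
Proof.
move=> cL; apply: DiffDef; first exact: linear_differentiable.
exact: diff_lin.
Qed.

(** Leibniz rule: matrix multiplication is a continuous bilinear map, hence differentiable, and the
    chain rule applies to its composite with the pair [(f, g)]. *)
Lemma is_diff_mulmx {K : realType} {V : normedModType K} {m n p : nat}
    {f df : V -> 'M[K]_(m, n)} {g dg : V -> 'M[K]_(n, p)} {x : V} :
  is_diff x f df -> is_diff x g dg ->
  is_diff x (fun y => f y *m g y) (fun h => f x *m dg h + df h *m g x).
Proof.
move=> dfx dgx.
have cM : continuous (fun q : 'M[K]_(m, n) * 'M[K]_(n, p) => q.1 *m q.2).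
  by move=> q; apply: cvg_mulmx; [exact: cvg_fst|exact: cvg_snd].
pose mulB : {bilinear 'M[K]_(m, n) -> 'M[K]_(n, p) -> 'M[K]_(m, p)} :=
  @mulmx K m n p.
have dM : is_diff (f x, g x) (fun q => q.1 *m q.2)
    (fun q : 'M[K]_(m, n) * 'M[K]_(n, p) => f x *m q.2 + q.1 *m g x).
  apply: DiffDef.
    exact: (@differentiable_bilin _ _ _ _ mulB (f x, g x) cM).
  exact: (@diff_bilin _ _ _ _ mulB (f x, g x) cM).
exact: (is_diff_comp (is_diff_pair dfx dgx) dM).
Qed.

Lemma is_diff_trmx {K : realType} {V : normedModType K} {m n : nat}
    {f df : V -> 'M[K]_(m, n)} {x : V} :
  is_diff x f df -> is_diff x (fun y => (f y)^T) (fun h => (df h)^T).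
Proof.
move=> dfx.
have dT : is_diff (f x) (@trmx K m n) (@trmx K m n).
  apply: (is_diff_continuous_linear (@trmx K m n : {linear _ -> _})) => A.
  exact: (@cvg_trmx K m n _ (nbhs A) _ idfun A (@cvg_id _ _)).
exact: (is_diff_comp dfx dT).
Qed.

Lemma is_diff_dotc {K : realType} {V : normedModType K} {n : nat}
    {f df g dg : V -> 'cV[K]_n} {x : V} :
  is_diff x f df -> is_diff x g dg ->
  is_diff x (fun y => dotc (f y) (g y))
    (fun h => dotc (f x) (dg h) + dotc (df h) (g x)).
Proof.
move=> dfx dgx.
(* Reading the entry of a 1 by 1 matrix is linear and continuous, so it is its own differential. *)
pose e := fun M : 'M[K]_1 => M 0 0.
have lin : linear e by move=> a A B; rewrite /e !mxE.
pose L : {linear 'M[K]_1 -> K} :=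
  HB.pack e (GRing.isLinear.Build _ _ _ _ _ lin).
have de A : is_diff A e e.
  by apply: (is_diff_continuous_linear L); exact: coord_continuous.
have dfg := is_diff_comp (is_diff_mulmx (is_diff_trmx dfx) dgx) (de _).
apply: (is_diff_eq dfg).
by apply/funext => h; rewrite /= /dotc /e mxE.
Qed.

(** * Inner product algebra and matrices representing differentials *)

Lemma dotcDr {K : realType} {n : nat} (u v w : 'cV[K]_n) :
  dotc u (v + w) = dotc u v + dotc u w.
Proof. by rewrite /dotc mulmxDr mxE. Qed.

Lemma dotcDl {K : realType} {n : nat} (u v w : 'cV[K]_n) :
  dotc (u + v) w = dotc u w + dotc v w.
Proof. by rewrite /dotc linearD /= mulmxDl mxE. Qed.

Lemma dotcC {K : realType} {n : nat} (u v : 'cV[K]_n) : dotc u v = dotc v u.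
Proof. by rewrite /dotc !mxE; apply: eq_bigr => i _; rewrite !mxE mulrC. Qed.

Lemma dotc0l {K : realType} {n : nat} (v : 'cV[K]_n) : dotc 0 v = 0.
Proof. by rewrite /dotc linear0 mul0mx mxE. Qed.

Lemma dotc_mulmxr {K : realType} {n k : nat} (u : 'cV[K]_k) (A : 'M[K]_(k, n))
    (v : 'cV[K]_n) : dotc u (A *m v) = dotc (A^T *m u) v.
Proof. by rewrite /dotc trmx_mul trmxK mulmxA. Qed.

Lemma dotc_delta {K : realType} {n : nat} (u : 'cV[K]_n) (j : 'I_n) :
  dotc u (delta_mx j 0) = u j 0.
Proof.
rewrite /dotc mxE (bigD1 j) //= big1 ?addr0 => [|i /negbTE ij].
  by rewrite !mxE !eqxx mulr1.
by rewrite !mxE ij mulr0.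
Qed.

(** Testing the differential on the standard basis recovers its representing vector. Every gradient
    of the Hamiltonian is computed this way: differentiate, then move all matrices to the left of
    the inner product. *)
Lemma gradE {K : realType} {n : nat} {phi dphi : 'cV[K]_n -> K}
    {x c : 'cV[K]_n} :
  is_diff x phi dphi -> (forall h, dphi h = dotc c h) -> grad phi x = c.
Proof.
move=> [_ dphiE] dphic; apply/matrixP => j k.
by rewrite !mxE ord1 dphiE dphic dotc_delta.
Qed.

(** Expand [h] in the standard basis. Linearity is a plain hypothesis so that the result also
    applies to the map $h\mapsto(DF(x)[h])u$. *)
Lemma col_lin_mxE {K : realType} {n k : nat} (L : 'cV[K]_n -> 'cV[K]_k)
    (h : 'cV[K]_n) : linear L -> L h = col_lin_mx L *m h.
Proof.
move=> linL.
pose L' : {linear 'cV[K]_n -> 'cV[K]_k} :=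
  HB.pack L (GRing.isLinear.Build _ _ _ _ _ linL).
rewrite -[L h]/(L' h) {1}(matrix_sum_delta h) linear_sum.
apply/matrixP => i j; rewrite ord1 summxE mxE.
by apply: eq_bigr => l _; rewrite big_ord1 linearZ /= !mxE mulrC.
Qed.

Lemma diff_jac {K : realType} {n k : nat} (f : 'cV[K]_n -> 'cV[K]_k)
    (x h : 'cV[K]_n) : 'd f x h = jac f x *m h.
Proof. by apply: col_lin_mxE; exact: linearP. Qed.

Lemma diff_grad {K : realType} {n : nat} (phi : 'cV[K]_n -> K)
    (x h : 'cV[K]_n) : 'd phi x h = dotc (grad phi x) h.
Proof.
rewrite {1}(matrix_sum_delta h) linear_sum /dotc mxE.
by apply: eq_bigr => l _; rewrite big_ord1 linearZ /= !mxE mulrC.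
Qed.

Lemma diff_dmat {K : realType} {n k m : nat} (F : 'cV[K]_n -> 'M[K]_(k, m))
    (x h : 'cV[K]_n) (u : 'cV[K]_m) : 'd F x h *m u = dmat F x u *m h.
Proof.
apply: (col_lin_mxE (fun h => 'd F x h *m u)) => a v w.
by rewrite linearP mulmxDl scalemxAl.
Qed.

Lemma posdef_unitmx {K : realType} {m : nat} (R : 'M[K]_m) :
  posdef_mx R -> R \in unitmx.
Proof.
(* The freeness criterion tests row vectors on the left; transposing first turns [v *m R^T = 0] into
   [R *m v^T = 0], which contradicts positivity of the quadratic form unless [v] is zero. *)
move=> Rpos; rewrite -unitmx_tr -row_free_unit; apply: inj_row_free => v vR0.
apply/eqP; rewrite -trmx_eq0; apply: contraT => /Rpos.
by rewrite -[R *m _]trmxK trmx_mul trmxK vR0 trmx0 dotcC dotc0l ltxx.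
Qed.

(** * Gradients of the Hamiltonian in costate, control and state *)

Section hamiltonian_gradients.
Context {K : realType} {n m p : nat} (T : K).
Context (f0 : 'cV[K]_n -> K) (f1 : 'cV[K]_n -> 'cV[K]_n).
Context (F2 : 'cV[K]_n -> 'M[K]_(n, m)) (g1 : 'cV[K]_n -> 'cV[K]_p).
Context (G2 : 'cV[K]_n -> 'M[K]_(p, m)) (R : 'M[K]_m).
Context (x0 xf : 'cV[K]_n) (lam : 'cV[K]_p).

Let H := hamiltonian (rocp T f0 f1 F2 g1 G2 R x0 xf lam).

Lemma grad_costate_hamiltonian (x q : 'cV[K]_n) (u : 'cV[K]_m) :
  grad (fun q => H x q u) q = f1 x + F2 x *m u.
Proof.
apply: gradE => [|h].
  exact: (is_diffD (is_diff_cst _ _)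
    (is_diff_dotc (is_diff_id _) (is_diff_cst _ _))).
by rewrite /= add0r /dotc mulmx0 mxE add0r -/(dotc _ _) dotcC.
Qed.

Lemma grad_control_hamiltonian (x q : 'cV[K]_n) (u : 'cV[K]_m) :
  symmetric_mx R ->
  grad (fun v => H x q v) u = R *m u + (G2 x)^T *m lam + (F2 x)^T *m q.
Proof.
move=> Rsym.
have dM k (A : 'M[K]_(k, m)) : is_diff u (fun v => A *m v) (fun h => A *m h).
  apply: is_diff_eq.
    exact: (is_diff_mulmx (is_diff_cst A u) (is_diff_id u)).
  by apply/funext => h; rewrite mul0mx addr0.
have dA k (a : 'cV[K]_k) (A : 'M[K]_(k, m)) :
    is_diff u (fun v => a + A *m v) (fun h => A *m h).
  apply: (is_diff_eq (is_diffD (is_diff_cst a u) (dM k A))).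
  by apply/funext => h; rewrite /= add0r.
apply: gradE => [|h].
  exact: (is_diffD (is_diffD (is_diffD (is_diff_cst (f0 x) u)
      (is_diffZ 2^-1 (is_diff_dotc (is_diff_id u) (dM _ R))))
      (is_diff_dotc (is_diff_cst lam u) (dA _ (g1 x) (G2 x))))
    (is_diff_dotc (is_diff_cst q u) (dA _ (f1 x) (F2 x)))).
(* The quadratic cost contributes $\tfrac12(u^\top Rh+h^\top Ru)$; by symmetry of [R] both terms
   equal $(Ru)^\top h$, which absorbs the factor one half. *)
rewrite !fctE !dotc0l !addr0 add0r (dotcC h) !dotc_mulmxr Rsym !dotcDl.
have half (a : K) : 2^-1 * (a + a) = a by lra.
by congr (_ + _ + _); exact: half.
Qed.

Lemma grad_state_hamiltonian (x q : 'cV[K]_n) (u : 'cV[K]_m) :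
  differentiable f0 x -> differentiable f1 x -> differentiable F2 x ->
  differentiable g1 x -> differentiable G2 x ->
  grad (fun y => H y q u) x =
    grad f0 x + ((jac f1 x)^T + (dmat F2 x u)^T) *m q
              + ((jac g1 x)^T + (dmat G2 x u)^T) *m lam.
Proof.
move=> /differentiableP df0 /differentiableP df1 /differentiableP dF2.
move=> /differentiableP dg1 /differentiableP dG2.
have dM k (A : 'cV[K]_n -> 'M[K]_(k, m)) : is_diff x A ('d A x) ->
    is_diff x (fun y => A y *m u) (fun h => dmat A x u *m h).
  move=> dA; apply: (is_diff_eq (is_diff_mulmx dA (is_diff_cst u x))).
  by apply/funext => h; rewrite mulmx0 add0r diff_dmat.
apply: gradE => [|h].
  exact: (is_diffD (is_diffD (is_diffD df0 (is_diff_cst _ x))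
      (is_diff_dotc (is_diff_cst lam x) (is_diffD dg1 (dM _ _ dG2))))
    (is_diff_dotc (is_diff_cst q x) (is_diffD df1 (dM _ _ dF2)))).
rewrite !fctE !dotc0l !addr0 !diff_jac diff_grad.
(* Differentiating the Hamiltonian produces the [lam] terms before the [q] terms; [addrAC] restores
   the order of the reduced equation. *)
by rewrite !dotcDr !dotc_mulmxr !mulmxDl !dotcDl addrAC.
Qed.

End hamiltonian_gradients.

(** * Continuity on $[0,T]$ and essential boundedness of the control *)

Lemma abs_continuous_within {K : realType} {V : normedModType K} {T : K}
    {f : K -> V} :
  abs_continuous T f -> {within `[0, T], continuous f}.
Proof.
move=> fac; apply/subspace_continuousP => t.
rewrite /= in_itv /= => /andP[t0 tT].
apply/cvgrPdist_lt => e e0; have [d d0 fd] := fac e e0.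
(* Absolute continuity is used with a family of one interval, where disjointness is trivial. Its
   endpoints are ordered, hence the later comparison of [s] with [t]. *)
have close a b : 0 <= a -> a <= b -> b <= T -> b - a < d -> `|f b - f a| < e.
  move=> a0 ab bT bad.
  have := fd 1%N (fun=> a) (fun=> b) (fun=> conj a0 (conj ab bT)).
  rewrite !big_ord1; apply => //.
  by move=> i j _ _ _; rewrite !ord1.
rewrite near_withinE; near=> s; rewrite /= in_itv /= => /andP[s0 sT].
have : `|t - s| < d by near: s; apply/nbhs_ballP; exists d.
have [ts|/ltW st] := leP t s => tsd.
  by rewrite distrC close // -(ger0_norm (_ : 0 <= s - t)) ?subr_ge0 // distrC.
by rewrite close // -(ger0_norm (_ : 0 <= t - s)) ?subr_ge0.
Unshelve. all: by end_near. Qed.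

(** Each coordinate is measurable on $[0,T]$ by continuity and bounded there because the image of a
    compact interval is compact. *)
Lemma within_continuous_Linfty {K : realType} {m : nat} {T : K}
    {u : K -> 'cV[K]_m} :
  {within `[0, T], continuous u} -> Linfty T u.
Proof.
move=> uc i.
have ci : {within `[0, T], continuous (fun t => u t i 0)}.
  move=> t; apply: (cvg_comp _ (fun M : 'cV[K]_m => M i 0) (uc t)).
  exact: coord_continuous.
rewrite inE; apply/andP; split; rewrite inE /=.
  apply/(measurable_restrictT _ _).1; first exact: measurable_itv.
  apply: subspace_continuous_measurable_fun; last exact: ci.
  exact: measurable_itv.
have [M [_ Mub]] : bounded_set ((fun t => u t i 0) @` `[0, T]).
  apply: compact_bounded.
  by apply: continuous_compact; [exact: ci|exact: segment_compact].
(* Boundedness gives a bound for every real strictly above [M], hence [M + 1]; the maximum with 0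
   covers the points outside $[0,T]$, where the restriction is 0. *)
have uM t : `|((fun t => u t i 0) \_ `[0, T]) t| <= Num.max (M + 1) 0.
  rewrite patchE; case: ifPn => [|_]; last by rewrite normr0 le_max lexx orbT.
  rewrite inE => tT; rewrite le_max; apply/orP; left.
  by apply: Mub; [rewrite ltrDl|exists t].
rewrite /finite_norm unlock; case: ifP => _; last by rewrite ltry.
apply: (@le_lt_trans _ _ (Num.max (M + 1) 0)%:E); last exact: ltry.
by apply/ess_supP; apply: nearW => t; rewrite /= lee_fin.
Qed.

Lemma ustar_within_continuous {K : realType} {n m p : nat} {T : K}
    {F2 : 'cV[K]_n -> 'M[K]_(n, m)} {G2 : 'cV[K]_n -> 'M[K]_(p, m)}
    {R : 'M[K]_m} {lam : 'cV[K]_p} {x px : K -> 'cV[K]_n} :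
  continuous F2 -> continuous G2 ->
  {within `[0, T], continuous x} -> {within `[0, T], continuous px} ->
  {within `[0, T], continuous (ustar F2 G2 R lam x px)}.
Proof.
move=> cF cG cx cpx t; apply: cvgN; apply: cvg_mulmx; first exact: cvg_cst.
apply: cvgD; apply: cvg_mulmx.
- by apply: cvg_trmx; apply: (cvg_comp _ F2 (cx t)); exact: cF.
- exact: cpx.
- by apply: cvg_trmx; apply: (cvg_comp _ G2 (cx t)); exact: cG.
- exact: cvg_cst.
Qed.

(** * Pointwise equivalence of the reduced equations and the extremality conditions *)

Theorem proposition2p5 (K : realType) (n m p : nat)
    (f0 : 'cV[K]_n -> K) (f1 : 'cV[K]_n -> 'cV[K]_n)
    (F2 : 'cV[K]_n -> 'M[K]_(n, m)) (g1 : 'cV[K]_n -> 'cV[K]_p)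
    (G2 : 'cV[K]_n -> 'M[K]_(p, m)) (R : 'M[K]_m)
    (f0_C2 : is_Ck 2 f0) (f1_C2 : is_Ck 2 f1) (F2_C2 : is_Ck 2 F2)
    (g1_C2 : is_Ck 2 g1) (G2_C2 : is_Ck 2 G2)
    (R_sym : symmetric_mx R) (R_pos : posdef_mx R)
    (T : K) (T_gt0 : 0 < T) (x0 xf : 'cV[K]_n) (lam : 'cV[K]_p)
    (x px : K -> 'cV[K]_n)
    (x_ac : abs_continuous T x) (px_ac : abs_continuous T px) :
  rbvp T f0 f1 F2 g1 G2 R x0 xf lam x px <->
  extremal (rocp T f0 f1 F2 g1 G2 R x0 xf lam) x px
    (ustar F2 G2 R lam x px).
Proof.
move: f0_C2 f1_C2 F2_C2 g1_C2 G2_C2.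
move=> [df0 _] [df1 _] [dF2 _] [dg1 _] [dG2 _].
set u := ustar F2 G2 R lam x px.
have stateE t : f1 (x t) + F2 (x t) *m u t =
    f1 (x t) - F2 (x t) *m invmx R *m
      ((F2 (x t))^T *m px t + (G2 (x t))^T *m lam).
  by rewrite /u /ustar mulmxN mulmxA.
have costateE t : - grad f0 (x t)
      - ((jac f1 (x t))^T + (dmat F2 (x t) (u t))^T) *m px t
      - ((jac g1 (x t))^T + (dmat G2 (x t) (u t))^T) *m lam =
    - (grad f0 (x t) + ((jac f1 (x t))^T + (dmat F2 (x t) (u t))^T) *m px t
      + ((jac g1 (x t))^T + (dmat G2 (x t) (u t))^T) *m lam).
  by rewrite !opprD.
(* Positive definiteness makes [R] invertible, so [R *m u t] cancels the other two terms at every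
   [t]. *)
have controlE t : R *m u t + (G2 (x t))^T *m lam + (F2 (x t))^T *m px t = 0.
  rewrite /u /ustar mulmxN mulKVmx ?posdef_unitmx //.
  by rewrite -addrA [_ *m lam + _]addrC addNr.
split=> [[xE pxE xi xT]|[_ _ _ xpxE xi xT]]; split => //.
- apply: within_continuous_Linfty.
  apply: ustar_within_continuous; try exact: abs_continuous_within.
    by move=> y; exact: differentiable_continuous.
  by move=> y; exact: differentiable_continuous.
(* The two reduced equations hold off separate null sets; on the intersection of the full-measure
   sets all three extremality conditions hold together. *)
- apply: (filterS2 (ae_filter_ringOfSetsType _) _ xE pxE) => t xt pxt tT; split.
  + by rewrite grad_costate_hamiltonian stateE; exact: xt.
  + by rewrite grad_state_hamiltonian // -costateE; exact: pxt.
  + by rewrite grad_control_hamiltonian.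
(* Conversely, each reduced equation is read off the matching Hamiltonian equation at the same
   [t]. *)
- apply: (@filterS _ _ (ae_filter_ringOfSetsType _) _ _ _ xpxE) => t xpxt tT.
  have [xt _ _] := xpxt tT.
  by move: xt; rewrite grad_costate_hamiltonian stateE.
- apply: (@filterS _ _ (ae_filter_ringOfSetsType _) _ _ _ xpxE) => t xpxt tT u'.
  have [_ pxt _] := xpxt tT.
  by move: pxt; rewrite grad_state_hamiltonian // -costateE.
Qed.
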